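(* Let $k \ge 2$. (a) Suppose $a < b$ are coprime positive integers and $S = \langle a_1, \ldots, a_k\rangle$, where $a_i = a^{k-i} b^{i-1}$ for each $i = 1,\ldots,k$ and $a_1 < \cdots < a_k$ are the minimal generators of $S$. Then $\Delta_\infty(S) = \{1, 2, \ldots, b\}$. (b) Suppose $p_1, \ldots, p_k \in \mathbb{Z}_{\ge 1}$ are pairwise coprime with $p_1 > \cdots > p_k$, $T = p_1 \cdots p_k$, and $S = \langle a_1, \ldots, a_k\rangle$, where $a_i = \tfrac{1}{p_i}T$ for each $i = 1,\ldots,k$ and $a_1 < \cdots < a_k$ are the minimal generators of $S$. Then $\Delta_\infty(S) = \{1, 2, \ldots, p_1\}$.
   Context: A numerical semigroup is a cofinite, additively closed subset $S \subseteq \mathbb{Z}_{\ge 0}$ containing $0$; $\langle a_1, \ldots, a_k\rangle$ denotes the set of all $\mathbb{Z}_{\ge 0}$-linear combinations of $a_1,\ldots,a_k$. For $x \in S$, factorizations are taken with respect to the minimal generators: $\mathsf Z(x) = \{z \in \mathbb{Z}_{\ge 0}^k : x = z_1a_1 + \cdots + z_ka_k\}$. For $z \in \mathsf Z(x)$, $\ell_\infty(z) = \max(z_1,\ldots,z_k)$; $\mathcal L_\infty(x) = \{\ell_\infty(z) : z \in \mathsf Z(x)\}$. Writing $\mathcal L_\infty(x) = \{c_1 < \cdots < c_r\}$, put $\Delta_\infty(x) = \{c_i - c_{i-1} : i = 2, \ldots, r\}$, and $\Delta_\infty(S) = \bigcup_{x \in S} \Delta_\infty(x)$. *)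

(* Defs.v *)
From mathcomp Require Import all_boot.
From mathcomp Require Import boolp classical_sets functions cardinality.

Set Implicit Arguments.
Unset Strict Implicit.
Unset Printing Implicit Defensive.

Local Open Scope classical_set_scope.

Definition numerical_semigroup (S : set nat) : Prop :=
  [/\ S 0, (forall x y, S x -> S y -> S (x + y)) & finite_set (~` S)].

(* Indices start at 0: g i, for i : 'I_k, is the generator a_(i+1). *)
Definition generated (k : nat) (g : 'I_k -> nat) : set nat :=
  [set x | exists z : 'I_k -> nat, x = \sum_(i < k) z i * g i].

Definition generated_sub (k : nat) (g : 'I_k -> nat) (J : {set 'I_k}) :
    set nat :=
  [set x | exists z : 'I_k -> nat, x = \sum_(i in J) z i * g i].

Definition minimal_generators (S : set nat) (k : nat) (g : 'I_k -> nat) :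
    Prop :=
  [/\ forall i j : 'I_k, i < j -> g i < g j,
      S = generated g &
      forall J : {set 'I_k}, S = generated_sub g J -> J = [set: 'I_k]%SET].

Definition factorizations (k : nat) (g : 'I_k -> nat) (x : nat) :
    set ('I_k -> nat) :=
  [set z | x = \sum_(i < k) z i * g i].

Definition ell_inf (k : nat) (z : 'I_k -> nat) : nat := \max_(i < k) z i.

Definition length_set_inf (k : nat) (g : 'I_k -> nat) (x : nat) : set nat :=
  [set ell_inf z | z in factorizations g x].

(* c is the increasing enumeration of the (finite) length set of x. *)
Definition Delta_inf_elt (k : nat) (g : 'I_k -> nat) (x : nat) : set nat :=
  [set d | exists c : seq nat,
     [/\ sorted ltn c, [set` c] = length_set_inf g x &
         exists2 i : nat, i.+1 < size c & d = nth 0 c i.+1 - nth 0 c i]].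

(* Factorizations are relative to g, which is meant to satisfy
   minimal_generators S g. *)
Definition Delta_inf (k : nat) (g : 'I_k -> nat) (S : set nat) : set nat :=
  \bigcup_(x in S) Delta_inf_elt g x.

(* Main.v *)
Require Import Defs.
From mathcomp Require Import all_boot.
From mathcomp Require Import boolp classical_sets functions cardinality.
From mathcomp Require Import zify.

(** The two families share one mechanism.  Write [b] for the claimed maximum:
    [b] itself in the geometric case, [p_1] in the other one.

    Upper bound.  The relations between the generators come from binary
    trades, [b a_i = a a_(i+1)] in the geometric case and [p_i a_i = p_j a_j]
    in the other, and a trade moves every coordinate, hence [ell_inf], by at
    most [b].  Congruences show that, given two distinct factorizations of the
    same element, one of them can be traded towards the other so that their
    L1 distance drops.  Any two factorizations are therefore joined by a
    path along which [ell_inf] changes by at most [b] at each step, and such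
    a path cannot cross a gap longer than [b] ([gap_le_of_closer], fed by
    [geometric_closer] and [coprime_products_closer]).

    Realization.  Both families satisfy [b a_1 = a a_2] for some [a < b], while
    [b] divides every generator but [a_1] and is coprime to [a_1].  For
    [x = e a_1 + N a_2] with [e < b] this forces the first coordinate of a
    factorization to be congruent to [e] modulo [b].  If it equals [e], the
    rest is a factorization of [N a_2] by generators at least [a_2], so all
    its entries are at most [N]; otherwise it is at least [e + b].  As soon as
    [a <= N] and [e <= N < e + b], the lengths [N] and [e + b] both occur and
    are consecutive.  Suitable [e] and [N] give every difference from [1] to
    [b] ([consecutive_lengths], [gap_realized]). *)

Set Implicit Arguments.
Unset Strict Implicit.
Unset Printing Implicit Defensive.

Local Open Scope classical_set_scope.

(** * Gaps of a set of lengths *)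

Lemma sorted_seq_of_bounded (A : set nat) (n : nat) :
  (forall m, A m -> m <= n) ->
  exists2 c : seq nat, sorted ltn c & [set` c] = A.
Proof.
move=> An; exists [seq m <- iota 0 n.+1 | `[< A m >]].
  by apply: sorted_filter; [exact: ltn_trans | exact: iota_ltn_sorted].
apply/seteqP; split=> m; rewrite /mkset mem_filter mem_iota.
  by case/andP=> /asboolP.
by move=> Am; apply/andP; split; [exact/asboolP | rewrite add0n ltnS An].
Qed.

Lemma ell_inf_ge k (z : 'I_k -> nat) i : z i <= ell_inf z.
Proof. exact: leq_bigmax. Qed.

Lemma ell_inf_le k (z : 'I_k -> nat) m :
  (forall i, z i <= m) -> ell_inf z <= m.
Proof. by move=> zm; apply/bigmax_leqP => i _. Qed.

Lemma entry_mul_le k (g z : 'I_k -> nat) i : z i * g i <= \sum_(l < k) z l * g l.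
Proof. by rewrite (bigD1 i) //= leq_addr. Qed.

Lemma length_set_bounded k (g : 'I_k -> nat) x m :
  (forall i, 0 < g i) -> length_set_inf g x m -> m <= x.
Proof.
move=> g0 [z /= -> <-]; apply: ell_inf_le => i.
by apply: leq_trans (entry_mul_le g z i); rewrite leq_pmulr.
Qed.

(** Lets the arguments below handle only two lengths and the absence of others
    between them, never the enumeration of the length set. *)
Lemma Delta_inf_eltP k (g : 'I_k -> nat) x d : (forall i, 0 < g i) ->
  Delta_inf_elt g x d <->
  exists m n, [/\ length_set_inf g x m, length_set_inf g x n, m < n,
    (forall l, length_set_inf g x l -> l <= m \/ n <= l) & d = n - m].
Proof.
move=> g0; split.
  case=> c [sc <- [i ic ->]]; exists (nth 0 c i), (nth 0 c i.+1).
  have lt_nth u v : u < size c -> v < size c ->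
      u < v -> nth 0 c u < nth 0 c v.
    by move=> uc vc; exact: (sorted_ltn_nth ltn_trans 0 sc).
  have i0c : i < size c by apply: ltnW.
  split=> //=; [exact: mem_nth | exact: mem_nth | exact: lt_nth |].
  move=> l /= lc; rewrite -(nth_index 0 lc).
  have jc : index l c < size c by rewrite index_mem.
  case: (ltngtP (index l c) i) => [ji|ij|->]; last by left.
    by left; apply: ltnW; exact: lt_nth.
  right; case: (ltngtP i.+1 (index l c)) => [ij'|ji|->] //.
    by apply: ltnW; exact: lt_nth.
  by rewrite ltnS leqNgt ij in ji.
case=> m [n [Lm Ln mn gap ->]].
have [c sc cL] := sorted_seq_of_bounded (fun l => @length_set_bounded k g x l g0).
have inc l : length_set_inf g x l -> l \in c by rewrite -cL.
have lt_idx u v : u \in c -> v \in c -> index u c < index v c -> u < v.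
  by move=> uc vc; exact: (sorted_ltn_index ltn_trans sc).
have idx_lt u v : u \in c -> v \in c -> u < v -> index u c < index v c.
  move=> uc vc uv; rewrite ltnNge leq_eqVlt.
  apply/negP => /orP[/eqP e|/(lt_idx _ _ vc uc)].
    by move: uv; rewrite -(nth_index 0 uc) -(nth_index 0 vc) e ltnn.
  by rewrite ltnNge ltnW.
have mc := inc _ Lm; have nc := inc _ Ln.
have idx_mn := idx_lt _ _ mc nc mn.
have next_c : (index m c).+1 < size c.
  by apply: leq_ltn_trans idx_mn _; rewrite index_mem.
exists c; split=> //; exists (index m c) => //.
rewrite nth_index //; congr (_ - _).
set l := nth 0 c _.
have lc : l \in c by exact: mem_nth.
have idx_l : index l c = (index m c).+1.
  by rewrite index_uniq // (sorted_uniq ltn_trans ltnn sc).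
have ml : m < l by apply: lt_idx; rewrite ?idx_l.
have /gap : length_set_inf g x l by rewrite -cL.
case=> [|nl]; first by rewrite leqNgt ml.
apply/eqP; rewrite eqn_leq nl leqNgt /=; apply/negP => /(idx_lt _ _ nc lc).
by rewrite idx_l ltnS leqNgt idx_mn.
Qed.

(** * Trades *)

(** A binary relation [u a_i = v a_j] applied to [z].  The subtraction is
    truncated, so this is meaningful only when [u <= z i]. *)
Definition trade k (z : 'I_k -> nat) i u j v : 'I_k -> nat :=
  fun l => if l == i then z i - u else if l == j then z j + v else z l.

Lemma big_ordD2 k (F : 'I_k -> nat) i j : i != j ->
  \sum_(l < k) F l = F i + (F j + \sum_(l < k | (l != i) && (l != j)) F l).
Proof. by move=> ij; rewrite (bigD1 i) //= (bigD1 j) //= eq_sym. Qed.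

Lemma sum_trade k (g z : 'I_k -> nat) i u j v :
  i != j -> u <= z i -> u * g i = v * g j ->
  \sum_(l < k) trade z i u j v l * g l = \sum_(l < k) z l * g l.
Proof.
move=> ij uz uv; rewrite !(big_ordD2 _ ij) /trade eqxx (eq_sym j) (negbTE ij) eqxx /=.
rewrite !addnA mulnBl mulnDl -uv; congr (_ + _).
  by have := leq_mul uz (leqnn (g i)); lia.
by apply: eq_bigr => l /andP[/negbTE -> /negbTE ->].
Qed.

Definition near k b (y z : 'I_k -> nat) : Prop :=
  forall l, y l <= z l + b /\ z l <= y l + b.

Lemma near_sym k b (y z : 'I_k -> nat) : near b y z -> near b z y.
Proof. by move=> yz l; have [] := yz l. Qed.

Lemma ell_inf_near k b (y z : 'I_k -> nat) :
  near b y z -> ell_inf y <= ell_inf z + b.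
Proof.
move=> yz; apply: ell_inf_le => l; have [yl _] := yz l.
by apply: leq_trans yl _; rewrite leq_add2r ell_inf_ge.
Qed.

Lemma trade_near k b (z : 'I_k -> nat) i u j v :
  u <= b -> v <= b -> near b (trade z i u j v) z.
Proof.
move=> ub vb l; rewrite /trade; case: eqP => [->|_]; first by lia.
by case: eqP => [->|_]; lia.
Qed.

Definition l1_dist k (z z' : 'I_k -> nat) : nat :=
  \sum_(l < k) ((z l - z' l) + (z' l - z l)).

Lemma l1_distC k (z z' : 'I_k -> nat) : l1_dist z z' = l1_dist z' z.
Proof. by apply: eq_bigr => l _; rewrite addnC. Qed.

Lemma l1_dist_trade k (z z' : 'I_k -> nat) i u j v :
  i != j -> 0 < u -> z' i + u <= z i -> v < u \/ z j + v <= z' j ->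
  l1_dist (trade z i u j v) z' < l1_dist z z'.
Proof.
move=> ij u0 uz vu; rewrite /l1_dist.
rewrite !(big_ordD2 _ ij) /trade eqxx (eq_sym j) (negbTE ij) eqxx /=.
rewrite (eq_bigr (fun l => (z l - z' l) + (z' l - z l))); last first.
  by move=> l /andP[/negbTE -> /negbTE ->].
set rest := \sum_(l < k | _) _; lia.
Qed.

(** * Upper bound *)

(** The step may start from either factorization, because in the geometric case
    only the one with the larger first differing entry has enough copies to
    trade away. *)
Definition closer k (g : 'I_k -> nat) x b (z z' : 'I_k -> nat) : Prop :=
  exists2 y, factorizations g x y &
    near b y z /\ l1_dist y z' < l1_dist z z' \/
    near b y z' /\ l1_dist z y < l1_dist z z'.

Lemma closer_sym k (g : 'I_k -> nat) x b z z' :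
  closer g x b z z' -> closer g x b z' z.
Proof.
by case=> y Fy [] [yz lt]; exists y => //; [right | left];
  split=> //; rewrite ![l1_dist z' _]l1_distC // [l1_dist y _]l1_distC.
Qed.

Lemma closer_trade k (g : 'I_k -> nat) x b z z' i u j v :
  factorizations g x z -> i != j -> u * g i = v * g j ->
  0 < u <= b -> v <= b -> z' i + u <= z i -> v < u \/ z j + v <= z' j ->
  closer g x b z z'.
Proof.
move=> Fz ij uv /andP[u0 ub] vb uz vu; exists (trade z i u j v).
  by rewrite /factorizations /= sum_trade //; lia.
by left; split; [exact: trade_near | exact: l1_dist_trade].
Qed.

(** A pair of factorizations on the two sides of a gap longer than [b] stays
    on its sides under a step of size at most [b]; such steps would lower the
    distance forever. *)
Lemma gap_le_of_closer k (g : 'I_k -> nat) x b d :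
  (forall i, 0 < g i) ->
  (forall z z', factorizations g x z -> factorizations g x z' ->
     (exists l, z l != z' l) -> closer g x b z z') ->
  Delta_inf_elt g x d -> d <= b.
Proof.
move=> g0 step /(Delta_inf_eltP _ _ g0)[m [n [Lm Ln mn gap ->]]].
rewrite leqNgt; apply/negP => bd.
case: Lm Ln => [z Fz zm] [z' Fz' z'n].
have {zm} zm : ell_inf z <= m by rewrite zm.
have {z'n} z'n : n <= ell_inf z' by rewrite z'n.
have [N] := ubnP (l1_dist z z').
elim: N z z' Fz Fz' zm z'n => // N IH z z' Fz Fz' zm z'n dN.
have [[l zl]|eqz] := pselect (exists l, z l != z' l); last first.
  (* Pointwise equal factorizations lie on the same side of the gap. *)
  suff : ell_inf z = ell_inf z' by lia.
  apply: eq_bigr => l _; apply/eqP; apply: contrapT => /negP zl.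
  by apply: eqz; exists l.
case: (step z z' Fz Fz') => [|y Fy]; first by exists l.
have Ly : length_set_inf g x (ell_inf y) by exists y.
case=> -[yz lt].
  apply: (IH y z') => //; last by lia.
  by have := ell_inf_near yz; have [] := gap _ Ly => //; lia.
apply: (IH z y) => //; last by lia.
by have := ell_inf_near (near_sym yz); have [] := gap _ Ly => //; lia.
Qed.

(** Reducing the equality of the two sums modulo [c * m] leaves the single
    coordinate [i]; this is what makes trades of [m] copies of [i] possible. *)
Lemma factorization_congr k (g z z' : 'I_k -> nat) i c h m :
  0 < c -> coprime h m -> g i = c * h ->
  (forall l, l != i -> z l = z' l \/ c * m %| g l) ->
  \sum_(l < k) z l * g l = \sum_(l < k) z' l * g l ->
  z i = z' i %[mod m].
Proof.
move=> c0 hm gi others; rewrite !(bigD1 (P := xpredT) i) //= => eq_sums.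
have rest : \sum_(l < k | l != i) z l * g l =
            \sum_(l < k | l != i) z' l * g l %[mod c * m].
  apply: (big_ind2 (fun u v => u = v %[mod c * m])) => //.
    by move=> u1 v1 u2 v2 e1 e2; rewrite -modnDm e1 e2 modnDm.
  move=> l /others[-> //|dv].
  by rewrite !(eqP (dvdn_mull _ dv)).
have {eq_sums rest} : z i * g i = z' i * g i %[mod c * m].
  apply/eqP; rewrite -(eqn_modDr (\sum_(l < k | l != i) z l * g l)) eq_sums.
  by rewrite eqn_modDl rest.
rewrite gi; wlog le_z : z z' {others} / z i <= z' i => [th e|/esym/eqP].
  by case: (leqP (z i) (z' i)) => [/th|/ltnW/th th']; [exact | apply/esym/th'].
rewrite eqn_mod_dvd ?leq_mul2r ?le_z ?orbT // -mulnBl mulnCA.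
rewrite dvdn_pmul2l // Gauss_dvdl 1?coprime_sym // -eqn_mod_dvd //.
by move/eqP.
Qed.

Lemma congr_lt_gap m u v : u = v %[mod m] -> u < v -> u + m <= v.
Proof.
move=> /esym/eqP + uv; rewrite (eqn_mod_dvd _ (ltnW uv)) => dv.
by have := dvdn_leq _ dv; rewrite subn_gt0 uv => /(_ isT); lia.
Qed.

(** The trade happens at the first coordinate where the factorizations differ:
    dividing out the powers of [b] shows that they differ there by a multiple
    of [b].  Since [a < b], trading [b] entries for [a] lowers the distance
    wherever the [a] new entries end up. *)
Lemma geometric_closer k a b (g : 'I_k -> nat) x z z' :
  0 < a -> a < b -> coprime a b ->
  (forall i, g i = a ^ (k - i.+1) * b ^ i) ->
  factorizations g x z -> factorizations g x z' ->
  (exists l, z l != z' l) -> closer g x b z z'.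
Proof.
move=> a0 ab cab gE Fz Fz' [l0 l0P].
case: (@arg_minnP _ l0 (fun l => z l != z' l) val l0P) => i.
move: Fz Fz' {l0 l0P}.
wlog lt_z : z z' / z' i < z i => [th Fz Fz' zi first_i|].
  have [zz|zz|e] := ltngtP (z' i) (z i); [exact: th | | by rewrite e eqxx in zi].
  apply: closer_sym; apply: th => //; first by rewrite eq_sym.
  by move=> l; rewrite eq_sym; exact: first_i.
move=> Fz Fz' _ first_i.
have eq_sums : \sum_(l < k) z' l * g l = \sum_(l < k) z l * g l by rewrite -Fz -Fz'.
have b0 : 0 < b by lia.
have eq_before (l : 'I_k) : l < i -> z' l = z l.
  move=> li; apply/eqP; rewrite eq_sym; apply: contraLR li => /first_i.
  by rewrite -leqNgt.
(* A difference in the last coordinate alone would change the sum. *)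
have ik : i.+1 < k.
  rewrite ltnNge; apply/negP => ki.
  have : z' i * g i < z i * g i.
    by rewrite ltn_pmul2r // gE muln_gt0 !expn_gt0 a0 b0.
  move: eq_sums; rewrite !(bigD1 (P := xpredT) i) //=.
  rewrite (eq_bigr (fun l => z l * g l)) => [|l li]; first by lia.
  rewrite eq_before //; move: li; rewrite -val_eqE /=.
  by have := ltn_ord l; lia.
have cong : z' i = z i %[mod b].
  apply: (@factorization_congr _ g _ _ i (b ^ i) (a ^ (k - i.+1)) b) => //.
  - by rewrite expn_gt0 b0.
  - exact: coprimeXl.
  - by rewrite gE mulnC.
  move=> l li; have [il|{}li|e] := ltngtP i l; last 2 first.
  - by left; exact: eq_before.
  - by rewrite -val_eqE /= e eqxx in li.
  by right; rewrite gE -expnSr dvdn_mull // dvdn_exp2l.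
apply: (@closer_trade _ _ _ _ _ _ i b (Ordinal ik) a) => //.
- by rewrite -val_eqE /=; lia.
- rewrite !gE /= mulnCA -expnS mulnA -expnS; congr (_ ^ _ * _); lia.
- by rewrite b0 leqnn.
- exact: ltnW.
- exact: congr_lt_gap.
- by left.
Qed.

(** Some entry of [z] exceeds that of [z'] and some other one falls short of it,
    both by multiples of the respective [p_i], so one trade brings both entries
    nearer to [z']. *)
Lemma coprime_products_closer k (p g : 'I_k -> nat) b x z z' :
  (forall i, 0 < p i) -> (forall i, p i <= b) ->
  (forall i j, i != j -> coprime (p i) (p j)) ->
  (forall i, g i = \prod_(l < k | l != i) p l) ->
  factorizations g x z -> factorizations g x z' ->
  (exists l, z l != z' l) -> closer g x b z z'.
Proof.
move=> p0 pb cop gE Fz Fz' [l0 l0P].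
have pg i : p i * g i = \prod_(l < k) p l by rewrite gE [RHS](bigD1 i).
have g0 i : 0 < g i by rewrite gE prodn_gt0.
have cong w w' i : factorizations g x w -> factorizations g x w' ->
    w i = w' i %[mod p i].
  move=> Fw Fw'; apply: (@factorization_congr _ g _ _ i 1 (g i) (p i)) => //.
  - rewrite gE; apply: (big_ind (fun u => coprime u (p i))).
    + exact: coprime1n.
    + by move=> u v; rewrite coprimeMl => -> ->.
    + by move=> l; exact: cop.
  - by rewrite mul1n.
  - by move=> l li; right; rewrite mul1n gE (bigD1 i) 1?eq_sym //= dvdn_mulr.
  - by rewrite -Fw -Fw'.
(* Equal weighted sums cannot be comparable coordinatewise unless equal. *)
have above w w' : factorizations g x w -> factorizations g x w' ->
    (exists l, w l != w' l) -> exists i, w' i < w i.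
  move=> Fw Fw' [l wl]; apply: contrapT => none.
  have le_w i : w i <= w' i by rewrite leqNgt; apply/negP => lt; apply: none; exists i.
  have : \sum_(i < k) w i * g i < \sum_(i < k) w' i * g i.
    rewrite (bigD1 l) //= [ltnRHS](bigD1 l) //=.
    rewrite -addSn leq_add ?ltn_pmul2r //; first by rewrite ltn_neqAle wl le_w.
    by apply: leq_sum => i _; rewrite leq_mul2r le_w orbT.
  by rewrite -Fw -Fw' ltnn.
have [i zi] : exists i, z' i < z i by apply: above => //; exists l0.
have [j zj] : exists j, z j < z' j.
  by apply: above => //; exists l0; rewrite eq_sym.
apply: (@closer_trade _ _ _ _ _ _ i (p i) j (p j)) => //.
- by apply/eqP => e; rewrite e in zi; lia.
- by rewrite !pg.
- by rewrite p0 pb.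
- by apply: congr_lt_gap => //; exact: cong.
- by right; apply: congr_lt_gap => //; exact: cong.
Qed.

(** * Realization *)

(** The bound [a <= N] is what allows trading [a] copies of [a_2] for [b] copies
    of [a_1], which produces the length [e + b]; the bound [N < e + b] makes it
    exceed the length [N] of the untraded factorization. *)
Lemma consecutive_lengths k (g : 'I_k -> nat) i0 i1 a b e N :
  i0 != i1 -> (forall i, 0 < g i) -> (forall i, i != i0 -> g i1 <= g i) ->
  (forall i, i != i0 -> b %| g i) -> coprime (g i0) b ->
  b * g i0 = a * g i1 -> e < b -> a <= N -> e <= N < e + b ->
  Delta_inf_elt g (e * g i0 + N * g i1) (e + b - N).
Proof.
move=> i01 g0 g1min dvb cop ab eb aN /andP[eN Nb].
pose z l := if l == i0 then e else if l == i1 then N else 0.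
have zi0 : z i0 = e by rewrite /z eqxx.
have zi1 : z i1 = N by rewrite /z eq_sym (negbTE i01) eqxx.
have sum_z : \sum_(l < k) z l * g l = e * g i0 + N * g i1.
  rewrite (bigD1 i0) //= (bigD1 i1) /=; last by rewrite eq_sym.
  rewrite zi0 zi1 big1 ?addn0 // => l /andP[l0 l1].
  by rewrite /z (negbTE l0) (negbTE l1).
have z_le l : z l <= N by rewrite /z; case: ifP => // _; case: ifP.
pose y := trade z i1 a i0 b.
apply/Delta_inf_eltP => //; exists N, (e + b); split=> //.
- exists z; first by rewrite /factorizations /= sum_z.
  by apply/eqP; rewrite eqn_leq ell_inf_le // -{1}zi1 ell_inf_ge.
- exists y; first by rewrite /factorizations /= sum_trade ?sum_z // 1?eq_sym // zi1.
  have yi0 : y i0 = e + b by rewrite /y /trade (negbTE i01) eqxx zi0.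
  apply/eqP; rewrite eqn_leq -{2}yi0 ell_inf_ge andbT; apply: ell_inf_le => l.
  rewrite /y /trade; case: ifP => _; first by rewrite zi1; lia.
  by case: ifP => _; [rewrite zi0 | have := z_le l; lia].
move=> _ [w Fw <-]; have {Fw} Fw : \sum_(l < k) w l * g l = \sum_(l < k) z l * g l.
  by rewrite sum_z -Fw.
have cong : w i0 = z i0 %[mod b].
  apply: (@factorization_congr _ g _ _ i0 1 (g i0) b) => //; first by rewrite mul1n.
  by move=> l l0; right; rewrite mul1n dvb.
have [w0|w0] := leqP (w i0) e; last first.
  right; apply: leq_trans (ell_inf_ge w i0).
  by apply: congr_lt_gap => //; rewrite cong zi0.
have {cong w0} w0 : w i0 = e.
  by move: cong; rewrite zi0 !modn_small //; exact: leq_ltn_trans eb.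
left; apply: ell_inf_le => l; have [->|l0] := eqVneq l i0; first by rewrite w0.
rewrite -(leq_pmul2r (g0 i1)).
apply: (@leq_trans (w l * g l)); first by rewrite leq_mul2l g1min ?orbT.
move: Fw; rewrite sum_z (bigD1 i0) //= w0 (bigD1 l) //=; lia.
Qed.

(** For [d < b] the factorization with [d] copies of [a_1] and [b] of [a_2] has
    length [b], and the next length is [d + b].  This breaks down at [d = b],
    where the first coordinate could drop to [0]; there [a] copies of each give
    the consecutive lengths [a] and [a + b]. *)
Lemma gap_realized k (g : 'I_k -> nat) i0 i1 a b d :
  i0 != i1 -> (forall i, 0 < g i) -> (forall i, i != i0 -> g i1 <= g i) ->
  (forall i, i != i0 -> b %| g i) -> coprime (g i0) b ->
  b * g i0 = a * g i1 -> a < b -> 1 <= d <= b ->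
  exists x, Delta_inf_elt g x d.
Proof.
move=> i01 g0 g1min dvb cop abE ab /andP[d0 db].
have lens e N := @consecutive_lengths _ g i0 i1 a b e N i01 g0 g1min dvb cop abE.
move: db; rewrite leq_eqVlt => /orP[/eqP ->|db].
  exists (a * g i0 + a * g i1); have := lens a a ab (leqnn a).
  by rewrite addKn; apply; lia.
exists (d * g i0 + b * g i1); have := lens d b db (ltnW ab).
by rewrite addnK; apply; lia.
Qed.

Lemma Delta_inf_eq k (g : 'I_k -> nat) i0 i1 a b :
  i0 != i1 -> (forall i, 0 < g i) -> (forall i, i != i0 -> g i1 <= g i) ->
  (forall i, i != i0 -> b %| g i) -> coprime (g i0) b ->
  b * g i0 = a * g i1 -> a < b ->
  (forall x z z', factorizations g x z -> factorizations g x z' ->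
     (exists l, z l != z' l) -> closer g x b z z') ->
  Delta_inf g (generated g) = [set d | 1 <= d <= b].
Proof.
move=> i01 g0 g1min dvb cop abE ab step; apply/seteqP; split=> d /=.
  case=> x _ Dd; rewrite (gap_le_of_closer g0 (step x) Dd) andbT.
  by have /(Delta_inf_eltP _ _ g0)[m [n [_ _ mn _ ->]]] := Dd; rewrite subn_gt0.
move=> db; have [x Dd] := gap_realized i01 g0 g1min dvb cop abE ab db.
exists x => //.
by have /(Delta_inf_eltP _ _ g0)[m [n [[z Fz _] _ _ _ _]]] := Dd; exists z.
Qed.

Theorem theorem3p1 (k : nat) (hk : 2 <= k) :
  (forall (a b : nat) (g : 'I_k -> nat) (S : set nat),
     0 < a -> a < b -> coprime a b ->
     (forall i : 'I_k, g i = a ^ (k - i.+1) * b ^ i) ->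
     numerical_semigroup S ->
     S = generated g ->
     minimal_generators S g ->
     Delta_inf g S = [set d | 1 <= d <= b])
  /\
  (forall (p : 'I_k -> nat) (T : nat) (g : 'I_k -> nat) (S : set nat),
     (forall i : 'I_k, 1 <= p i) ->
     (forall i j : 'I_k, i != j -> coprime (p i) (p j)) ->
     (forall i j : 'I_k, i < j -> p j < p i) ->
     T = \prod_(i < k) p i ->
     (forall i : 'I_k, g i = T %/ p i) ->
     numerical_semigroup S ->
     S = generated g ->
     minimal_generators S g ->
     Delta_inf g S = [set d | 1 <= d <= p (Ordinal (ltnW hk))]).
Proof.
pose i0 := Ordinal (ltnW hk); pose i1 := Ordinal hk.
have i01 : i0 != i1 by [].
have pos (i : 'I_k) : i != i0 -> 0 < i by rewrite -val_eqE /= -lt0n.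
have g1min (g : 'I_k -> nat) : (forall i j : 'I_k, i < j -> g i < g j) ->
    forall i, i != i0 -> g i1 <= g i.
  move=> incr i /pos i_gt0; have [->//|i1i] := eqVneq i i1.
  by apply: ltnW; apply: incr; move: i1i; rewrite -val_eqE /=; lia.
split=> [a b g S a0 ab cab gE _ -> [/g1min g1min' _ _]
        |p T g S p0 cop decr TE gE _ -> [/g1min g1min' _ _]].
  have b0 : 0 < b by lia.
  apply: (@Delta_inf_eq _ g i0 i1 a) => //.
  - by move=> i; rewrite gE muln_gt0 !expn_gt0 a0 b0.
  - by move=> i /pos i_gt0; rewrite gE dvdn_mull // dvdn_exp.
  - by rewrite gE expn0 muln1 coprimeXl.
  - rewrite !gE /= expn0 muln1 expn1 mulnA -expnS mulnC; congr (_ ^ _ * _); lia.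
  - by move=> x z z'; exact: (geometric_closer a0 ab cab gE).
have {TE} gE i : g i = \prod_(l < k | l != i) p l.
  by rewrite gE TE (bigD1 i) //= mulKn ?p0.
have pg i : p i * g i = \prod_(l < k) p l by rewrite gE [RHS](bigD1 i).
apply: (@Delta_inf_eq _ g i0 i1 (p i1)) => //.
- by move=> i; rewrite gE prodn_gt0.
- by move=> i i_i0; rewrite gE (bigD1 i0) 1?eq_sym //= dvdn_mulr.
- rewrite gE; apply: (big_ind (fun u => coprime u (p i0))).
  + exact: coprime1n.
  + by move=> u v; rewrite coprimeMl => -> ->.
  + by move=> l; exact: cop.
- by rewrite !pg.
- exact: decr.
- move=> x z z'; apply: coprime_products_closer => // i.
  by have [->|/pos i_gt0] := eqVneq i i0; last by apply: ltnW; apply: decr.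
Qed.
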